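(* Let $A$ be a nonempty convex $\tau_X$-open subset of $X$ and let $T:A\to Y$ be a single-valued mapping. Suppose that $T$ is Gâteaux differentiable on $A$ (i.e. at every point of $A$). If $T$ is order increasing on $A$, then for every $\bar x\in A$, $T'(\bar x)(v)\succcurlyeq_K\theta_Y$ for every $v\succ_C\theta_X$ (that is, for every $v\in C\setminus\{\theta_X\}$).
   Context: An $F$-seminorm on a real vector space $X$ is a map $p:X\to[0,\infty)$ with $p(x+y)\le p(x)+p(y)$; $p(ax)\le p(x)$ for all scalars $|a|\le 1$; and $p(a_nx)\to0$ for every $x$ and every sequence of positive numbers $a_n\to0$. It is positive if not identically $0$. A topology is induced by a family $\mathbb{F}$ of $F$-seminorms if for every point $x_0$ the sets $\{x:\max\{p(x-x_0):p\in I\}<\lambda\}$, with $I\subseteq\mathbb{F}$ nonempty finite and $\lambda>0$, form a base of open neighborhoods of $x_0$. $(X,\tau_X,\preccurlyeq_C)$ and $(Y,\tau_Y,\preccurlyeq_K)$ are partially ordered real Hausdorff topological vector spaces with origins $\theta_X,\theta_Y$: $\tau_X,\tau_Y$ are induced by families $\mathbb{F}_X,\mathbb{F}_Y$ of positive $F$-seminorms; $C\subseteq X$ and $K\subseteq Y$ are nonempty closed convex pointed cones with $C\ne\{\theta_X\}$, $K\ne\{\theta_Y\}$; $x_1\preccurlyeq_C x_2$ means $x_2-x_1\in C$, $x_1\prec_C x_2$ means $x_2-x_1\in C\setminus\{\theta_X\}$, and $y_1\preccurlyeq_K y_2$ means $y_2-y_1\in K$. $\mathcal{F}_Y$ is the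 collection of nonempty finite subsets of $\mathbb{F}_Y$. $T$ is order increasing on $A$ if for all $x_1,x_2\in A$, $x_1\preccurlyeq_C x_2$ implies $T(x_1)\preccurlyeq_K T(x_2)$. $T$ is Gâteaux differentiable at $\bar x\in A$ with Gâteaux derivative $T'(\bar x)$ if for every $v\in X\setminus\{\theta_X\}$ there is $T'(\bar x)(v)\in Y$ such that for every $J\in\mathcal{F}_Y$ and $\varepsilon>0$ there is $\delta>0$ (with $\bar x+tv\in A$ for $|t|<\delta$) such that $0<|t|<\delta$ implies $\max\left\{q\left(\frac{T(\bar x+tv)-T(\bar x)-tT'(\bar x)(v)}{t}\right):q\in J\right\}<\varepsilon$. *)

(* Defs.v *)
From HB Require Import structures.
From mathcomp Require Import all_boot all_order all_algebra finmap.
From mathcomp Require Import all_classical all_reals all_analysis.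

Set Implicit Arguments.
Unset Strict Implicit.
Unset Printing Implicit Defensive.

Import Order.TTheory GRing.Theory Num.Theory.
Import numFieldNormedType.Exports.

Local Open Scope classical_set_scope.
Local Open Scope ring_scope.

Section FSeminorms.
Context {R : realType} {X : lmodType R}.
Implicit Types (p : X -> R) (F : set (X -> R)) (I : {fset X -> R}).

Definition is_fseminorm p :=
  [/\ forall x, 0 <= p x,
      forall x y, p (x + y) <= p x + p y,
      forall (a : R) x, `|a| <= 1 -> p (a *: x) <= p x
    & forall (x : X) (a : R^nat), (forall n, 0 < a n) ->
        a n @[n --> \oo] --> (0 : R) -> p (a n *: x) @[n --> \oo] --> (0 : R)].

Definition positive_fseminorm p := is_fseminorm p /\ exists x, p x != 0.

Definition nonempty_fsubset F I := I != fset0 /\ [set` I] `<=` F.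

(* The default value 0 of the iterated maximum is harmless: F-seminorms are
   nonnegative and I is nonempty wherever this is used. *)
Definition max_fseminorm I (x : X) : R := \big[Num.max/0]_(p <- I) p x.

Definition fseminorm_balls F (x0 : X) : set (set X) :=
  [set B | exists I (l : R), [/\ nonempty_fsubset F I, 0 < l
                              & B = [set x | max_fseminorm I (x - x0) < l]]].

End FSeminorms.

(* The convergence reads: every neighborhood of x0 contains a ball at x0. *)
Definition topology_induced_by {R : realType} {X : preTopologicalLmodType R}
    (F : set (X -> R)) :=
  forall x0 : X, fseminorm_balls F x0 `<=` open /\
                 filter_from (fseminorm_balls F x0) id --> x0.

Definition closed_convex_pointed_cone {R : realType}
    {X : preTopologicalLmodType R} (C : set X) :=
  [/\ C !=set0,
      closed C,
      convex_set (C : set (convex_lmodType X)),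
      forall (a : R) x, 0 <= a -> C x -> C (a *: x)
    & C `&` [set - x | x in C] = [set 0]].

Definition cone_le {R : realType} {X : lmodType R} (C : set X) (x y : X) :=
  C (y - x).

Definition cone_lt {R : realType} {X : lmodType R} (C : set X) (x y : X) :=
  (C `\` [set 0]) (y - x).

(* A map from A to Y is represented by a function on all of X, whose values
   outside A play no role; the same holds in is_gateaux_derivative. *)
Definition order_increasing_on {R : realType} {X Y : lmodType R}
    (C : set X) (K : set Y) (A : set X) (T : X -> Y) :=
  forall x1 x2, A x1 -> A x2 -> cone_le C x1 x2 -> cone_le K (T x1) (T x2).

(* T'x stands for the map v |-> T'(x)(v); it is not assumed to be linear, and
   its value at 0 is unconstrained. *)
Definition is_gateaux_derivative {R : realType} {X Y : lmodType R}
    (FY : set (Y -> R)) (A : set X) (T : X -> Y) (x : X) (T'x : X -> Y) :=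
  forall v : X, v != 0 ->
  forall (J : {fset Y -> R}) (e : R), nonempty_fsubset FY J -> 0 < e ->
  exists d : R, [/\ 0 < d,
    forall t : R, `|t| < d -> A (x + t *: v)
  & forall t : R, 0 < `|t| < d ->
      max_fseminorm J (t^-1 *: (T (x + t *: v) - T x - t *: T'x v)) < e].

(* Main.v *)
Require Import Defs.
From mathcomp Require Import all_boot all_order all_algebra finmap.
From mathcomp Require Import all_classical all_reals all_analysis.

Set Implicit Arguments.
Unset Strict Implicit.
Unset Printing Implicit Defensive.

Import Order.TTheory GRing.Theory Num.Theory.
Import numFieldNormedType.Exports.

Local Open Scope classical_set_scope.
Local Open Scope ring_scope.

(* K is closed, so it suffices that T'(x)(v) lies in its closure. For small
   t > 0 the difference quotient (T(x + tv) - T(x)) / t lies in K, by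
   monotonicity of T and scaling in K, and these quotients approximate
   T'(x)(v) in every F-seminorm ball. *)
Theorem theorem9p13 (R : realType) (X Y : topologicalLmodType R)
    (FX : set (X -> R)) (FY : set (Y -> R))
    (FX_pos : FX `<=` positive_fseminorm) (FY_pos : FY `<=` positive_fseminorm)
    (FX_top : topology_induced_by FX) (FY_top : topology_induced_by FY)
    (hausX : hausdorff_space X) (hausY : hausdorff_space Y)
    (C : set X) (K : set Y)
    (coneC : closed_convex_pointed_cone C) (C_neq0 : C <> [set 0])
    (coneK : closed_convex_pointed_cone K) (K_neq0 : K <> [set 0])
    (A : set X) (A_nonempty : A !=set0)
    (A_convex : convex_set (A : set (convex_lmodType X))) (A_open : open A)
    (T : X -> Y) (T' : X -> X -> Y)
    (T_diff : forall x, A x -> is_gateaux_derivative FY A T x (T' x))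
    (T_incr : order_increasing_on C K A T) :
  forall xbar, A xbar -> forall v, cone_lt C 0 v -> cone_le K 0 (T' xbar v).
Proof.
move=> x Ax v; rewrite /cone_lt /cone_le !subr0 => -[Cv /eqP v_neq0].
have [_ clK _ Kscale _] := coneK; have [_ _ _ Cscale _] := coneC.
(* Closedness is inclusion of the closure of [K] in [K], so each neighborhood [B] of [T' x v] has to
   meet [K]. *)
apply: clK => B nbhsB.
have [_ ball_cvg] := FY_top (T' x v).
have [_ [J [l [FJ l_gt0 ->]]] ballB] := ball_cvg B nbhsB.
(* The radius [l] of the ball inside [B] serves as the tolerance, and its index set [J] as the
   finite family of F-seminorms. *)
have [d [d_gt0 Ad dT]] := T_diff x Ax v v_neq0 J l FJ l_gt0.
(* Any [t] strictly between 0 and [d] would do; its sign lets both [t] and [t^-1] scale within the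
   cones. *)
pose t := d / 2.
have t_gt0 : 0 < t by rewrite divr_gt0.
have t_ltd : `|t| < d by rewrite gtr0_norm // ltr_pdivrMr // mulr_natr mulr2n ltrDl.
exists (t^-1 *: (T (x + t *: v) - T x)); split.
  apply: Kscale; first by rewrite invr_ge0 ltW.
  apply: T_incr => //; first exact: Ad.
  by rewrite /cone_le addrC addKr; apply: Cscale => //; exact: ltW.
apply: ballB => /=.
(* Since [T' x v] is [t^-1 *: (t *: T' x v)], the offset from the center of the ball is the quotient
   bounded by [dT]. *)
have -> : t^-1 *: (T (x + t *: v) - T x) - T' x v =
          t^-1 *: (T (x + t *: v) - T x - t *: T' x v).
  by rewrite [RHS]scalerBr scalerA mulVf ?scale1r ?gt_eqF.
by apply: dT; rewrite normr_gt0 gt_eqF.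
Qed.
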